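(* Let $d_a(\bm p_{sa},\overline{\bm p}_{sa})=\sum_{s'\in\mathcal{S}}\overline p_{sas'}\,\phi(p_{sas'}/\overline p_{sas'})$ with the Burg entropy $\phi(t)=-\log t+t-1$. If $\beta\ge\min\{\bm b\}+\omega$ for some $\omega>0$, then the projection problem $$\mathfrak{P}(\overline{\bm p}_{sa};\bm b,\beta)=\min\{d_a(\bm p_{sa},\overline{\bm p}_{sa}):\ \bm b^\top\bm p_{sa}\le\beta,\ \bm p_{sa}\in\Delta_S\}$$ can be solved to $\delta$-accuracy in time $\mathcal{O}\big(S\cdot\log[\max\{\bm b\}/(\delta\omega)]\big)$.
   Context: $\mathcal{S}=\{1,\dots,S\}$; $\Delta_S=\{\bm p\in\mathbb{R}^S_+:\mathbf{e}^\top\bm p=1\}$ is the probability simplex; $\overline{\bm p}_{sa}\in\Delta_S$ with $\overline{\bm p}_{sa}>\bm 0$ component-wise; $\bm b\in\mathbb{R}^S_+$, $\beta\in\mathbb{R}_+$; $\min\{\bm b\}$ and $\max\{\bm b\}$ are the smallest and largest components of $\bm b$. The convention $\log0=-\infty$ is used (so $\phi(0)=+\infty$). The projection problem is solved to $\delta$-accuracy ($\delta>0$) by any pair $(\underline d,\overline d)\in\mathbb{R}^2$ with $\mathfrak{P}(\overline{\bm p}_{sa};\bm b,\beta)\in[\underline d,\overline d]$ and $\overline d-\underline d\le\delta$. Time counts elementary operations (arithmetic, comparisons, and evaluations of $\log$). *)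

(* Defs.v *)
From HB Require Import structures.
From mathcomp Require Import all_boot all_order all_algebra.
From mathcomp Require Import all_classical all_reals all_analysis.

Set Implicit Arguments.
Unset Strict Implicit.
Unset Printing Implicit Defensive.

Import Order.TTheory GRing.Theory Num.Theory.
Import numFieldNormedType.Exports.

Local Open Scope classical_set_scope.
Local Open Scope ring_scope.

Section Projection.
Context {R : realType}.

(* [lne 0 = -oo], hence [burg 0 = +oo]. *)
Definition burg (t : R) : \bar R := (- lne t%:E + t%:E - 1)%E.

Definition simplex n : set 'rV[R]_n :=
  [set p : 'rV[R]_n | (forall s, 0 <= p 0 s) /\ \sum_s p 0 s = 1].

Definition dvg n (p pbar : 'rV[R]_n) : \bar R :=
  (\sum_s (pbar 0%R s)%:E * burg (p 0 s / pbar 0 s)%R)%E.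

Definition feasible n (b : 'rV[R]_n) (beta : R) : set 'rV[R]_n :=
  [set p : 'rV[R]_n | \sum_s b 0 s * p 0 s <= beta /\ simplex p].

(* [v] is the optimal value of the projection problem; in particular, the
   minimum is attained. *)
Definition is_projection n (pbar b : 'rV[R]_n) (beta : R) (v : \bar R) : Prop :=
  (exists2 p, feasible b beta p & dvg p pbar = v) /\
  (forall p, feasible b beta p -> (v <= dvg p pbar)%E).

Definition solves n (pbar b : 'rV[R]_n) (beta delta dlo dhi : R) : Prop :=
  (exists2 v, is_projection pbar b beta v & (dlo%:E <= v <= dhi%:E)%E) /\
  dhi - dlo <= delta.

Definition vmin n (v : 'rV[R]_n.+1) : R := \big[Num.min/v 0 0]_s v 0 s.
Definition vmax n (v : 'rV[R]_n.+1) : R := \big[Num.max/v 0 0]_s v 0 s.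

End Projection.

(* Computation model: a real random-access machine with natural-number index
   registers, real registers and real arrays, programmed in a while language.
   The operations on reals are exact field operations, logarithm and comparison;
   only integer constants are available, and reals cannot be converted to
   indices (no rounding). *)

Inductive iexp : Type :=
  | IConst of nat
  | IReg of nat
  | IAdd of iexp & iexp
  | ISub of iexp & iexp.

Inductive rexp : Type :=
  | RConst of int
  | RReg of nat
  | RArr of nat & iexp
  | RAdd of rexp & rexp
  | RSub of rexp & rexp
  | RMul of rexp & rexp
  | RDiv of rexp & rexp
  | RLog of rexp.

Inductive bexp : Type :=
  | BILt of iexp & iexp
  | BRLt of rexp & rexp
  | BNot of bexp
  | BAnd of bexp & bexp.

Inductive cmd : Type :=
  | Skip
  | ISet of nat & iexp
  | RSet of nat & rexp
  | ASet of nat & iexp & rexp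
  | Seq of cmd & cmd
  | If of bexp & cmd & cmd
  | While of bexp & cmd.

(* Every node of an expression is charged one unit, so that reading a constant,
   a register or an array cell and index arithmetic are counted as well. *)
Fixpoint icost (e : iexp) : nat :=
  match e with
  | IConst _ | IReg _ => 1
  | IAdd e1 e2 | ISub e1 e2 => (icost e1 + icost e2).+1
  end.

Fixpoint rcost (e : rexp) : nat :=
  match e with
  | RConst _ | RReg _ => 1
  | RArr _ i => (icost i).+1
  | RAdd e1 e2 | RSub e1 e2 | RMul e1 e2 | RDiv e1 e2 =>
      (rcost e1 + rcost e2).+1
  | RLog e1 => (rcost e1).+1
  end.

Fixpoint bcost (e : bexp) : nat :=
  match e with
  | BILt e1 e2 => (icost e1 + icost e2).+1
  | BRLt e1 e2 => (rcost e1 + rcost e2).+1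
  | BNot e1 => (bcost e1).+1
  | BAnd e1 e2 => (bcost e1 + bcost e2).+1
  end.

Section Semantics.
Context {R : realType}.

Record state : Type := State {
  ireg : nat -> nat;
  rreg : nat -> R;
  rarr : nat -> nat -> R }.

Fixpoint ieval (st : state) (e : iexp) : nat :=
  match e with
  | IConst k => k
  | IReg x => ireg st x
  | IAdd e1 e2 => (ieval st e1 + ieval st e2)%N
  | ISub e1 e2 => (ieval st e1 - ieval st e2)%N
  end.

(* Division by zero and logarithms of nonpositive numbers take the (total)
   library values; a program can detect these cases by a comparison. *)
Fixpoint reval (st : state) (e : rexp) : R :=
  match e with
  | RConst z => z%:~R
  | RReg x => rreg st x
  | RArr a i => rarr st a (ieval st i)
  | RAdd e1 e2 => reval st e1 + reval st e2
  | RSub e1 e2 => reval st e1 - reval st e2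
  | RMul e1 e2 => reval st e1 * reval st e2
  | RDiv e1 e2 => reval st e1 / reval st e2
  | RLog e1 => ln (reval st e1)
  end.

Fixpoint beval (st : state) (e : bexp) : bool :=
  match e with
  | BILt e1 e2 => (ieval st e1 < ieval st e2)%N
  | BRLt e1 e2 => reval st e1 < reval st e2
  | BNot e1 => ~~ beval st e1
  | BAnd e1 e2 => beval st e1 && beval st e2
  end.

Definition set_ireg (st : state) (x k : nat) : state :=
  State [eta ireg st with x |-> k] (rreg st) (rarr st).

Definition set_rreg (st : state) (x : nat) (r : R) : state :=
  State (ireg st) [eta rreg st with x |-> r] (rarr st).

Definition set_rarr (st : state) (a i : nat) (r : R) : state :=
  State (ireg st) (rreg st)
    (fun a' i' => if (a' == a) && (i' == i) then r else rarr st a' i').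

(* [exec c st t st']: started in [st], [c] halts in [st'] after time [t]. *)
Inductive exec : cmd -> state -> nat -> state -> Prop :=
  | exec_Skip st : exec Skip st 0 st
  | exec_ISet st x e :
      exec (ISet x e) st (icost e).+1 (set_ireg st x (ieval st e))
  | exec_RSet st x e :
      exec (RSet x e) st (rcost e).+1 (set_rreg st x (reval st e))
  | exec_ASet st a i e :
      exec (ASet a i e) st (icost i + rcost e).+1
        (set_rarr st a (ieval st i) (reval st e))
  | exec_Seq c1 c2 st1 st2 st3 t1 t2 :
      exec c1 st1 t1 st2 -> exec c2 st2 t2 st3 ->
      exec (Seq c1 c2) st1 (t1 + t2) st3
  | exec_If e c1 c2 st st' t :
      exec (if beval st e then c1 else c2) st t st' ->
      exec (If e c1 c2) st (bcost e + t) st'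
  | exec_WhileF e c st :
      ~~ beval st e -> exec (While e c) st (bcost e) st
  | exec_WhileT e c st1 st2 st3 t1 t2 :
      beval st1 e -> exec c st1 t1 st2 -> exec (While e c) st2 t2 st3 ->
      exec (While e c) st1 (bcost e + t1 + t2) st3.

Definition array_of n (v : 'rV[R]_n) (i : nat) : R := oapp (v 0) 0 (insub i).

(* Input encoding: index register 0 holds the dimension, real registers 0 and 1
   hold [beta] and [delta], arrays 0 and 1 hold [pbar] and [b]; all the other
   registers and cells are zero. *)
Definition input n (pbar b : 'rV[R]_n) (beta delta : R) : state :=
  State [eta (fun=> 0%N) with 0%N |-> n]
        [eta (fun=> 0) with 0%N |-> beta, 1%N |-> delta]
        [eta (fun=> fun=> 0) with 0%N |-> array_of pbar, 1%N |-> array_of b].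

(* On these input data, the program [c] halts after time [t], with the bounds
   of a [delta]-accurate solution in real registers 0 and 1. *)
Definition solves_in_time (c : cmd) n (pbar b : 'rV[R]_n) (beta delta : R)
    (t : nat) : Prop :=
  exists2 st, exec c (input pbar b beta delta) t st &
    solves pbar b beta delta (rreg st 0) (rreg st 1).

End Semantics.

(* Main.v *)
Require Import Defs.
From HB Require Import structures.
From mathcomp Require Import all_boot all_order all_algebra.
From mathcomp Require Import all_classical all_reals all_analysis.
From mathcomp Require Import ring lra zify.
Import Order.TTheory GRing.Theory Num.Theory.
Import numFieldNormedType.Exports.
Local Open Scope ring_scope.

(** On the simplex the Burg divergence is sum_s pbar_s * ln (pbar_s / p_s), and
    the constraint sum_s p_s = 1 can be eliminated from its Lagrangian: with a
    multiplier [l] for the budget constraint b^T p <= beta, the stationary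
    point is p_s = pbar_s / (1 + l * (b_s - beta)), and the dual function is
      g(l) = sum_s pbar_s * ln (1 + l * (b_s - beta)),
    a concave function of one real variable on [0, 1 / (beta - min b)[.

    Weak duality ([dvg_ge_dual]) is ln x <= x - 1 applied termwise.  For strong
    duality ([strong_duality]), the slope g' tends to -oo at the right end of
    the domain, because of the states with b_s = min b; so either g'(0) <= 0, and
    [pbar] itself is optimal, or g' vanishes at some [l] by the intermediate
    value theorem, and the corresponding stationary point is feasible with
    divergence g(l) ([kkt_projection]).  In both cases the projection value is
    the maximum of g.

    The program bisects on the sign of g', keeping an interval [lo, lo + w] that
    contains a maximizer ([bracket], [bracket_halve]).  For l >= 0 the slope
    satisfies g'(l) <= max b, so by concavity the maximum of g lies between g(lo)
    and g(lo) + w * max b: the loop may stop as soon as w * max b <= delta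
    ([bracket_solves]).  This bound does not involve the smallest entry of
    [pbar], which is why the running time does not depend on it.  The initial
    width is 1 / (beta - min b) <= 1 / omega, hence about
    log2 (max b / (delta * omega)) halvings suffice ([exp2_ge_log],
    [runs_bisect]), each of which evaluates g' once, in time O(S).  The
    program does not know omega: it computes min b and uses the best value
    beta - min b. *)

Set Implicit Arguments.
Unset Strict Implicit.
Unset Printing Implicit Defensive.

(** * Lagrangian duality for the projection problem *)

Section Duality.
Context {R : realType}.
Implicit Types (beta delta l m : R).

Definition dual_obj n (pbar b : 'rV[R]_n) beta l : R :=
  \sum_s pbar 0 s * ln (1 + l * (b 0 s - beta)).

Definition dual_slope n (pbar b : 'rV[R]_n) beta l : R :=
  \sum_s pbar 0 s * (b 0 s - beta) / (1 + l * (b 0 s - beta)).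

(** The positivity condition is what makes the stationary point of the
    Lagrangian a positive vector and the logarithms in [dual_obj] genuine. *)
Definition dual_dom n (b : 'rV[R]_n) beta l : Prop :=
  0 <= l /\ forall s, 0 < 1 + l * (b 0 s - beta).

Lemma ln_le_subr1 (x : R) : 0 < x -> ln x <= x - 1.
Proof.
move=> x0; rewrite -[X in ln X](subrKC 1 x); apply: le_ln1Dx; lra.
Qed.

(** Concavity of the dual function, as a bound by its tangents: termwise, this
    is ln x <= x - 1 at the quotient x = (1 + m * c) / (1 + l * c), where
    c = b_s - beta. *)
Lemma dual_le_tangent n (pbar b : 'rV[R]_n) beta l m :
  (forall s, 0 <= pbar 0 s) -> dual_dom b beta l -> dual_dom b beta m ->
  dual_obj pbar b beta m <=
    dual_obj pbar b beta l + (m - l) * dual_slope pbar b beta l.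
Proof.
move=> p0 [_ dl] [_ dm]; rewrite /dual_obj /dual_slope mulr_sumr -big_split /=.
apply: ler_sum => s _.
have {}dl := dl s; have {}dm := dm s; have := p0 s.
set p := pbar 0 s; set c := b 0 s - beta in dl dm * => {}p0.
have -> : p * ln (1 + l * c) + (m - l) * (p * c / (1 + l * c)) =
          p * (ln (1 + l * c) + ((1 + m * c) / (1 + l * c) - 1)).
  by field; rewrite gt_eqF.
apply: ler_wpM2l => //; rewrite -lerBlDl -ln_div ?posrE//.
by apply: ln_le_subr1; rewrite divr_gt0.
Qed.

(** Weak duality.  Termwise, ln (x * t) <= x * t - 1 with x = 1 + l * c and
    t = p_s / pbar_s bounds the cost of a state from below by its contribution to
    the dual function minus l * c * p_s; these corrections sum up to
    l * (b^T p - beta) <= 0.  A state with p_s = 0 has infinite cost. *)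
Lemma dvg_ge_dual n (pbar b p : 'rV[R]_n) beta l :
  simplex pbar -> (forall s, 0 < pbar 0 s) -> dual_dom b beta l ->
  feasible b beta p -> ((dual_obj pbar b beta l)%:E <= dvg p pbar)%E.
Proof.
move=> [_ pbar1] pbar0 [l0 dl] [bp [p0 p1]].
have le_dual : dual_obj pbar b beta l <=
    \sum_s (pbar 0 s * ln (1 + l * (b 0 s - beta)) - l * (b 0 s - beta) * p 0 s).
  rewrite sumrB lerBrDl gerDr.
  have -> : \sum_s l * (b 0 s - beta) * p 0 s =
     l * (\sum_s b 0 s * p 0 s - beta * \sum_s p 0 s).
    rewrite [beta * _]mulr_sumr -sumrB mulr_sumr; apply: eq_bigr => s _; ring.
  by rewrite p1 mulr1 mulr_ge0_le0// subr_le0.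
apply: (le_trans (y := (\sum_s (pbar 0 s * ln (1 + l * (b 0 s - beta)) -
   l * (b 0 s - beta) * p 0 s))%:E)); first by rewrite lee_fin.
rewrite -sumEFin; apply: lee_sum => s _.
have {}pbar0 := pbar0 s; have {}p0 := p0 s; have {}dl := dl s.
rewrite /burg /lne; case: ifPn => [_|].
  rewrite (_ : (- -oo + _ - _)%E = +oo%E)// mulry gtr0_sg// mul1e.
  exact: leey.
rewrite -ltNge pmulr_lgt0 ?invr_gt0// => p0'.
rewrite -!(EFinN, EFinD, EFinM) lee_fin.
set c := b 0 s - beta in dl *.
rewrite [X in _ <= X](_ : _ = pbar 0 s * (- ln (p 0 s / pbar 0 s) +
   p 0 s / pbar 0 s - 1)); last by [].
rewrite [X in X <= _](_ : _ = pbar 0 s *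
    (ln (1 + l * c) - l * c * (p 0 s / pbar 0 s)));
  last by field; rewrite gt_eqF.
apply: ler_wpM2l; first exact: ltW.
set t := p 0 s / pbar 0 s.
have t0 : 0 < t by rewrite divr_gt0.
have := @ln_le_subr1 ((1 + l * c) * t) (mulr_gt0 dl t0).
rewrite lnM ?posrE//; lra.
Qed.

Lemma dual_slope_continuous n (pbar b : 'rV[R]_n) beta l :
  dual_dom b beta l -> {for l, continuous (dual_slope pbar b beta)}.
Proof.
move=> [_ dl]; rewrite /continuous_at /dual_slope; apply: cvg_big => [|s _].
  exact: add_continuous.
apply: cvgM; first exact: cvg_cst.
apply: cvgV; first by rewrite gt_eqF.
by apply: cvgD; [exact: cvg_cst|apply: cvgM; [exact: cvg_id|exact: cvg_cst]].
Qed.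

Lemma vmin_le n (b : 'rV[R]_n.+1) s : vmin b <= b 0 s.
Proof. exact: bigmin_le. Qed.

Lemma vmin_attained n (b : 'rV[R]_n.+1) : exists s, vmin b = b 0 s.
Proof.
rewrite /vmin; elim/big_ind: _ => [|_ _ [s ->] [t ->]|s _]; first by exists 0.
  by rewrite minEle; case: ifP => _; [exists s|exists t].
by exists s.
Qed.

Lemma le_vmax n (b : 'rV[R]_n.+1) s : b 0 s <= vmax b.
Proof. exact: le_bigmax. Qed.

Lemma dual_dom_vmin n (b : 'rV[R]_n.+1) beta l :
  0 <= l -> l * (beta - vmin b) < 1 -> dual_dom b beta l.
Proof.
move=> l0 l1; split=> // s.
have := ler_wpM2l l0 (vmin_le b s); lra.
Qed.

(** The conditions on the slope are primal feasibility and complementary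
    slackness for p_s = pbar_s / (1 + l * (b_s - beta)): indeed
    1 - sum_s p_s = l * dual_slope l, and b^T p - beta * sum_s p_s =
    dual_slope l. *)
Lemma kkt_projection n (pbar b : 'rV[R]_n) beta l :
  simplex pbar -> (forall s, 0 < pbar 0 s) -> dual_dom b beta l ->
  dual_slope pbar b beta l <= 0 -> l * dual_slope pbar b beta l = 0 ->
  is_projection pbar b beta (dual_obj pbar b beta l)%:E.
Proof.
move=> pbarS pbar0 dom_l slope_le0 compl.
split; last by move=> p; exact: dvg_ge_dual.
have [l0 dl] := dom_l.
pose p : 'rV[R]_n := \row_s (pbar 0 s / (1 + l * (b 0 s - beta))).
have p_gt0 s : 0 < p 0 s by rewrite mxE divr_gt0.
have sum_p : \sum_s p 0 s = 1.
  rewrite -[RHS](subr0 1) -[in RHS]compl -(proj2 pbarS) /dual_slope.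
  rewrite mulr_sumr -sumrB.
  apply: eq_bigr => s _; rewrite mxE; field; by rewrite gt_eqF.
exists p.
  split; last by split=> // s; exact: ltW.
  rewrite -subr_le0 -[in X in _ - X](mulr1 beta) -[in X in _ * X]sum_p mulr_sumr.
  rewrite -sumrB; apply: le_trans slope_le0; rewrite le_eqVlt; apply/orP; left.
  apply/eqP/eq_bigr => s _; rewrite mxE; field; by rewrite gt_eqF.
have dvgE : dvg p pbar =
    (\sum_s (pbar 0 s * ln (1 + l * (b 0 s - beta)) + (p 0 s - pbar 0 s)))%:E.
  rewrite -sumEFin; apply: eq_bigr => s _.
  rewrite /burg lne_EFin ?divr_gt0//.
  rewrite -!(EFinN, EFinD, EFinM); congr (_%:E).
  rewrite mxE; set c := 1 + _.
  have c0 : 0 < c by exact: dl.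
  have -> : pbar 0 s / c / pbar 0 s = c^-1 by field; rewrite !gt_eqF.
  rewrite lnV ?posrE//; field; by rewrite gt_eqF.
by rewrite dvgE big_split /= sumrB sum_p (proj2 pbarS) subrr addr0.
Qed.

(** Terms with b_s <= beta contribute negatively, and the other ones at most
    pbar_s * b_s, as l >= 0.  Partial sums are allowed for the sake of
    [strong_duality], where one very negative term is set apart. *)
Lemma partial_slope_le_vmax n (pbar b : 'rV[R]_n.+1) beta l (P : pred 'I_n.+1) :
  simplex pbar -> (forall s, 0 <= b 0 s) -> 0 <= beta -> dual_dom b beta l ->
  \sum_(s | P s) pbar 0 s * (b 0 s - beta) / (1 + l * (b 0 s - beta)) <= vmax b.
Proof.
move=> [p0 p1] b0 beta0 [l0 dl].
have M0 : 0 <= vmax b := le_trans (b0 0) (le_vmax b 0).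
apply: (le_trans (y := \sum_s pbar 0 s * vmax b)); last first.
  by rewrite -mulr_suml p1 mul1r.
rewrite [leLHS]big_mkcond; apply: ler_sum => s _.
case: (P s); last exact: mulr_ge0.
rewrite -mulrA; apply: ler_wpM2l => //.
have {}dl := dl s; rewrite ler_pdivrMr//.
have {}b0 := b0 s; have bM := le_vmax b s.
have [c0|c0] := leP 0 (b 0 s - beta).
  have : 0 <= vmax b * (l * (b 0 s - beta)) by rewrite !mulr_ge0.
  lra.
by apply: (le_trans (ltW c0)); rewrite mulr_ge0// ltW.
Qed.

(** When the slope is positive at 0, it is shown to be nonpositive at an explicit
    point [l1] of the domain, and the intermediate value theorem gives a zero in
    between. *)
Lemma strong_duality n (pbar b : 'rV[R]_n.+1) beta :
  simplex pbar -> (forall s, 0 < pbar 0 s) -> (forall s, 0 <= b 0 s) ->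
  0 <= beta -> vmin b < beta ->
  exists l, [/\ 0 <= l, l * (beta - vmin b) < 1 &
    is_projection pbar b beta (dual_obj pbar b beta l)%:E].
Proof.
move=> pbarS pbar0 b0 beta0 beta_gt.
have [slope0|slope0] := leP (dual_slope pbar b beta 0) 0.
  exists 0; split; rewrite ?mul0r//.
  apply: kkt_projection; rewrite ?mul0r//; split=> // s.
  by rewrite mul0r addr0.
have [s0 s0E] := vmin_attained b.
set om := beta - vmin b; have om0 : 0 < om by rewrite subr_gt0.
have M0 : 0 <= vmax b := le_trans (b0 0) (le_vmax b 0).
have p0 := pbar0 s0; have pom0 : 0 < pbar 0 s0 * om by rewrite mulr_gt0.
have D0 : 0 < pbar 0 s0 * om + vmax b by exact: ltr_wpDr.
(* [l1] is chosen so that 1 - l1 * om = pbar_s0 * om / (pbar_s0 * om + vmax b):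
   the term of the cheapest state [s0] in the slope at [l1] is then exactly
   - (pbar_s0 * om + vmax b), which outweighs all the other terms. *)
pose l1 := vmax b / (pbar 0 s0 * om + vmax b) / om.
have l10 : 0 <= l1 by rewrite !divr_ge0// ltW.
have l1om : l1 * om < 1.
  by rewrite /l1 divfK ?gt_eqF// ltr_pdivrMr// mul1r ltrDr.
have dom l : 0 <= l <= l1 -> dual_dom b beta l.
  case/andP=> l0 ll1; apply: dual_dom_vmin => //.
  by apply: le_lt_trans l1om; rewrite ler_wpM2r// ltW.
have slope1 : dual_slope pbar b beta l1 <= 0.
  have d1 : dual_dom b beta l1 by apply: dom; rewrite l10 lexx.
  rewrite /dual_slope (bigD1 s0)//=.
  have rest_le := partial_slope_le_vmax (predC1 s0) pbarS b0 beta0 d1.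
  rewrite (_ : _ / _ = - (pbar 0 s0 * om + vmax b)); last first.
    rewrite -s0E /l1 /om; field; rewrite ?gt_eqF//.
    rewrite (_ : _ + _ = pbar 0 s0 * om * om); last by rewrite /om; ring.
    by rewrite mulr_gt0.
  rewrite addrC subr_le0; apply: le_trans rest_le _.
  by rewrite lerDr ltW.
have cont : {within `[0, l1], continuous (dual_slope pbar b beta)}%classic.
  apply: continuous_in_subspaceT => l; rewrite inE/= in_itv/= => ll1.
  exact: dual_slope_continuous (dom _ ll1).
have : Num.min (dual_slope pbar b beta 0) (dual_slope pbar b beta l1) <= 0 <=
       Num.max (dual_slope pbar b beta 0) (dual_slope pbar b beta l1).
  by rewrite ge_min slope1 orbT le_max (ltW slope0).
case/(IVT l10 cont) => l; rewrite in_itv/= => ll1 sl.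
have [l0 le_l1] := andP ll1.
exists l; split=> //.
  by apply: le_lt_trans l1om; rewrite ler_wpM2r// ltW.
by apply: kkt_projection; rewrite ?sl ?mulr0//; exact: dom.
Qed.

(** The interval [lo, lo + w] contains a maximizer of the dual function.  Its
    right end may be that of the domain, where the dual function is -oo, hence
    the strict inequality imposed on the maximizer.  Maximality is expressed by
    the primal value, as the two are equivalent by duality. *)
Definition bracket n (pbar b : 'rV[R]_n.+1) beta lo w : Prop :=
  [/\ 0 <= lo, 0 < w, (lo + w) * (beta - vmin b) <= 1 &
    exists l, [/\ lo <= l <= lo + w, l * (beta - vmin b) < 1 &
      is_projection pbar b beta (dual_obj pbar b beta l)%:E]].

Lemma bracket_init n (pbar b : 'rV[R]_n.+1) beta :
  simplex pbar -> (forall s, 0 < pbar 0 s) -> (forall s, 0 <= b 0 s) ->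
  0 <= beta -> vmin b < beta ->
  bracket pbar b beta 0 (1 / (beta - vmin b)).
Proof.
move=> pbarS pbar0 b0 beta0 bmin; have om0 : 0 < beta - vmin b by rewrite subr_gt0.
split; rewrite ?add0r ?divr_gt0 ?divfK ?gt_eqF//.
have [l [l0 l1 proj]] := strong_duality pbarS pbar0 b0 beta0 bmin.
by exists l; split=> //; rewrite l0 ler_pdivlMr// ltW.
Qed.

(** If the slope at the midpoint [m] is positive, then by concavity every
    maximizer lies to the right of [m].  Otherwise, a maximizer to the right of
    [m] entails that [m] is a maximizer too, so the left half may be kept without
    any appeal to strict concavity. *)
Lemma bracket_halve n (pbar b : 'rV[R]_n.+1) beta lo w :
  simplex pbar -> (forall s, 0 < pbar 0 s) -> vmin b < beta ->
  bracket pbar b beta lo w ->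
  bracket pbar b beta
    (if 0 < dual_slope pbar b beta (lo + w / 2) then lo + w / 2 else lo) (w / 2).
Proof.
move=> pbarS pbar0 bmin [lo0 w0 low [l [/andP[lol llow] l1 proj]]].
have om0 : 0 < beta - vmin b by rewrite subr_gt0.
have pbar_ge0 s : 0 <= pbar 0 s by exact: ltW.
set m := lo + w / 2; have m0 : 0 <= m by rewrite /m; lra.
have wom0 : 0 < w * (beta - vmin b) by rewrite mulr_gt0.
have m1 : m * (beta - vmin b) < 1 by rewrite /m; lra.
have dom_m := dual_dom_vmin m0 m1.
have dom_l := dual_dom_vmin (le_trans lo0 lol) l1.
have dual_lm := dual_le_tangent pbar_ge0 dom_m dom_l.
(* the dual value at [l] is the primal value, which bounds the dual function *)
have dual_ml : dual_obj pbar b beta m <= dual_obj pbar b beta l.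
  have [[p feas_p dvg_p] _] := proj.
  by rewrite -lee_fin -dvg_p; exact: dvg_ge_dual.
have [slope_gt0|slope_le0] := ltP 0 (dual_slope pbar b beta m).
  split=> //; [by rewrite divr_gt0|by rewrite /m -addrA -splitr|].
  exists l; split=> //; rewrite /m -addrA -splitr llow andbT.
  rewrite leNgt; apply/negP => lm.
  have := mulr_gt0 slope_gt0 (_ : 0 < m - l); rewrite subr_gt0 => /(_ lm).
  by move: dual_lm dual_ml; lra.
split=> //; [by rewrite divr_gt0|exact: ltW|].
have [lm|ml] := leP l m; first by exists l; rewrite lol lm.
exists m; split=> //; first by rewrite lexx andbT /m lerDl ltW// divr_gt0.
suff -> : dual_obj pbar b beta m = dual_obj pbar b beta l by [].
apply/eqP; rewrite eq_le dual_ml; apply: le_trans dual_lm _.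
by rewrite gerDl mulr_ge0_le0// subr_ge0 ltW.
Qed.

(** The tangent at [lo] has slope at most [vmax b], so on the bracket the dual
    function exceeds its value at [lo] by at most w * vmax b. *)
Lemma bracket_solves n (pbar b : 'rV[R]_n.+1) beta delta lo w :
  simplex pbar -> (forall s, 0 < pbar 0 s) -> (forall s, 0 <= b 0 s) ->
  0 <= beta -> vmin b < beta ->
  bracket pbar b beta lo w -> w * vmax b <= delta ->
  solves pbar b beta delta
    (dual_obj pbar b beta lo) (dual_obj pbar b beta lo + delta).
Proof.
move=> pbarS pbar0 b0 beta0 bmin [lo0 w0 low [l [/andP[lol llow] l1 proj]]] wM.
have om0 : 0 < beta - vmin b by rewrite subr_gt0.
have dom_l := dual_dom_vmin (le_trans lo0 lol) l1.
have dom_lo : dual_dom b beta lo.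
  by apply: dual_dom_vmin => //; apply: le_lt_trans l1; rewrite ler_pM2r.
split; last by rewrite addrAC subrr add0r.
exists (dual_obj pbar b beta l)%:E => //; apply/andP; split.
  have [[p feas_p <-] _] := proj; exact: dvg_ge_dual.
rewrite lee_fin; have pbar_ge0 s : 0 <= pbar 0 s by exact: ltW.
apply: le_trans (dual_le_tangent pbar_ge0 dom_lo dom_l) _.
rewrite lerD2l; apply: le_trans wM.
apply: (le_trans (y := (l - lo) * vmax b)).
  by rewrite ler_wpM2l ?subr_ge0//; exact: (partial_slope_le_vmax xpredT).
by rewrite ler_wpM2r ?lerBlDl// (le_trans (b0 0))// le_vmax.
Qed.

End Duality.

(** * Timed execution of programs *)

Section Programs.
Context {R : realType}.
Implicit Types (st : @state R).

(** Execution time is only tracked up to an upper bound, so that branches of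
    different cost can be treated uniformly. *)
Definition runs c st T st' := exists2 t, (t <= T)%N & exec c st t st'.

Lemma runs_exec c st t st' : exec c st t st' -> runs c st t st'.
Proof. by exists t. Qed.

Lemma runs_le c st T T' st' : (T <= T')%N -> runs c st T st' ->
  runs c st T' st'.
Proof. by move=> TT' [t tT ct]; exists t => //; exact: leq_trans tT TT'. Qed.

Lemma runs_Seq c1 c2 st1 st2 st3 T1 T2 :
  runs c1 st1 T1 st2 -> runs c2 st2 T2 st3 ->
  runs (Seq c1 c2) st1 (T1 + T2) st3.
Proof.
move=> [t1 tT1 ct1] [t2 tT2 ct2]; exists (t1 + t2)%N; first exact: leq_add.
exact: exec_Seq ct1 ct2.
Qed.

Lemma runs_RSet st x e :
  runs (RSet x e) st (rcost e).+1 (set_rreg st x (reval st e)).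
Proof. exact/runs_exec/exec_RSet. Qed.

Lemma runs_If e c1 c2 st T st' :
  runs (if beval st e then c1 else c2) st T st' ->
  runs (If e c1 c2) st (bcost e + T) st'.
Proof.
move=> [t tT ct]; exists (bcost e + t)%N; first by rewrite leq_add2l.
exact: exec_If.
Qed.

Lemma runs_WhileF e c st : ~~ beval st e -> runs (While e c) st (bcost e) st.
Proof. by move=> ne; exact/runs_exec/exec_WhileF. Qed.

Lemma runs_WhileT e c st1 st2 st3 T1 T2 :
  beval st1 e -> runs c st1 T1 st2 -> runs (While e c) st2 T2 st3 ->
  runs (While e c) st1 (bcost e + T1 + T2) st3.
Proof.
move=> he [t1 tT1 ct1] [t2 tT2 ct2]; exists (bcost e + t1 + t2)%N.
  by rewrite leq_add// leq_add2l.
exact: exec_WhileT he ct1 ct2.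
Qed.

(** The loop counts down because [bigop] is a right fold: the accumulator then
    equals a big operator over the indices already visited, for any operation.
    This covers minima and maxima, which have no neutral element in a realType
    and so cannot be unfolded from the other end. *)
Definition downto (body : cmd) : cmd :=
  Seq (ISet 1 (IReg 0))
      (While (BILt (IConst 0) (IReg 1))
             (Seq (ISet 1 (ISub (IReg 1) (IConst 1))) body)).

(** The states met while a loop over register 1 accumulates its result in real
    register [x]: nothing else changes, so that they are known exactly. *)
Definition scan st (x k : nat) (a : R) : state :=
  set_rreg (set_ireg st 1 k) x a.

Lemma scan_self st x k : set_ireg st 1 k = scan st x k (rreg st x).
Proof.
rewrite /scan /set_rreg; congr State; apply/funext => y /=.
by case: eqP => [->|].
Qed.

Lemma scan_rreg st x k a a' : set_rreg (scan st x k a) x a' = scan st x k a'.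
Proof.
by rewrite /scan /set_rreg; congr State; apply/funext => y /=; case: eqP.
Qed.

Lemma scan_set_rreg st x k a a' : scan (set_rreg st x a') x k a = scan st x k a.
Proof.
by rewrite /scan /set_rreg; congr State; apply/funext => y /=; case: eqP.
Qed.

Lemma scan_ireg st x k k' a : set_ireg (scan st x k a) 1 k' = scan st x k' a.
Proof.
rewrite /scan /set_rreg /set_ireg; congr State; apply/funext => y /=.
by case: eqP.
Qed.

Lemma runs_downto st x body (op : R -> R -> R) (F : nat -> R) T :
  (forall k a, (k < ireg st 0)%N ->
    runs body (scan st x k a) T (scan st x k (op (F k) a))) ->
  runs (downto body) st (5 + ireg st 0 * (7 + T))
    (scan st x 0 (\big[op/rreg st x]_(0 <= i < ireg st 0) F i)).
Proof.
move=> body_op; set n := ireg st 0.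
pose acc k := \big[op/rreg st x]_(k <= i < n) F i.
suff loop k : (k <= n)%N ->
    runs (While (BILt (IConst 0) (IReg 1))
             (Seq (ISet 1 (ISub (IReg 1) (IConst 1))) body))
      (scan st x k (acc k)) (3 + k * (7 + T)) (scan st x 0 (acc 0)).
  have := loop n (leqnn n); rewrite {1}/acc big_geq// -scan_self => run_loop.
  apply: (runs_le _ (runs_Seq (runs_exec (exec_ISet st 1 (IReg 0))) run_loop)).
  by rewrite /=; lia.
elim: k => [_|k IHk ltkn]; first exact: runs_WhileF.
have accE : acc k = op (F k) (acc k.+1) by rewrite /acc big_ltn.
pose st1 := scan st x k.+1 (acc k.+1).
have run_body : runs body
    (set_ireg st1 1 (ieval st1 (ISub (IReg 1) (IConst 1)))) T
    (scan st x k (acc k)).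
  by rewrite /= subn1 scan_ireg accE; exact: body_op.
have run_step := runs_Seq (runs_exec (exec_ISet st1 _ _)) run_body.
apply: (runs_le _ (runs_WhileT _ run_step (IHk (ltnW ltkn)))) => //=; lia.
Qed.

Definition fold_cmd (x : nat) (e : rexp) (body : cmd) : cmd :=
  Seq (RSet x e) (downto body).

Lemma runs_fold st x e body (op : R -> R -> R) (F : nat -> R) T :
  (forall k a, (k < ireg st 0)%N ->
    runs body (scan st x k a) T (scan st x k (op (F k) a))) ->
  runs (fold_cmd x e body) st (6 + rcost e + ireg st 0 * (7 + T))
    (scan st x 0 (\big[op/reval st e]_(0 <= k < ireg st 0) F k)).
Proof.
move=> body_op; pose st0 := set_rreg st x (reval st e).
have st0E k a : scan st0 x k a = scan st x k a by exact: scan_set_rreg.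
have run_loop : runs (downto body) st0 (5 + ireg st 0 * (7 + T))
    (scan st x 0 (\big[op/reval st e]_(0 <= k < ireg st 0) F k)).
  have := @runs_downto st0 x body op F T; rewrite st0E /= eqxx; apply=> k a.
  by rewrite !st0E; exact: body_op.
by apply: runs_le (runs_Seq (runs_RSet st x e) run_loop); lia.
Qed.

Definition sum_cmd (x : nat) (e : rexp) : cmd :=
  fold_cmd x (RConst (Posz 0)) (RSet x (RAdd e (RReg x))).

Lemma runs_sum st x e (F : nat -> R) :
  (forall k a, (k < ireg st 0)%N -> reval (scan st x k a) e = F k) ->
  runs (sum_cmd x e) st (7 + ireg st 0 * (10 + rcost e))
    (scan st x 0 (\sum_(0 <= k < ireg st 0) F k)).
Proof.
move=> eF; have body k a : (k < ireg st 0)%N ->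
    runs (RSet x (RAdd e (RReg x))) (scan st x k a) (3 + rcost e)
      (scan st x k (F k + a)).
  move=> ltkn; have := runs_RSet (scan st x k a) x (RAdd e (RReg x)).
  by rewrite /= eF// eqxx scan_rreg; apply: runs_le; lia.
by have := runs_fold (RConst (Posz 0)) body; apply: runs_le; rewrite /=; lia.
Qed.

End Programs.

(** * The bisection program *)

(** Use of the real registers: 0 and 1 hold beta and delta, and finally the
    result; 2 and 3 hold the extreme values of [b]; 4 and 5 hold the left
    end and the width of the bracket; 6 holds its midpoint; 7 accumulates
    sums.  Index register 1 is the loop variable. *)

Definition deviation : rexp := RSub (RArr 1 (IReg 1)) (RReg 0).

Definition scaled (x : nat) : rexp :=
  RAdd (RConst (Posz 1)) (RMul (RReg x) deviation).

Definition slope_cmd : cmd :=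
  sum_cmd 7 (RDiv (RMul (RArr 0 (IReg 1)) deviation) (scaled 6)).

Definition dual_cmd : cmd :=
  sum_cmd 7 (RMul (RArr 0 (IReg 1)) (RLog (scaled 4))).

Definition min_cmd : cmd :=
  fold_cmd 2 (RArr 1 (IConst 0))
    (If (BRLt (RArr 1 (IReg 1)) (RReg 2)) (RSet 2 (RArr 1 (IReg 1))) Skip).

Definition max_cmd : cmd :=
  fold_cmd 3 (RArr 1 (IConst 0))
    (If (BRLt (RArr 1 (IReg 1)) (RReg 3)) Skip (RSet 3 (RArr 1 (IReg 1)))).

Definition halve_cmd : cmd :=
  Seq (RSet 5 (RDiv (RReg 5) (RConst (Posz 2))))
  (Seq (RSet 6 (RAdd (RReg 4) (RReg 5)))
  (Seq slope_cmd
       (If (BRLt (RConst (Posz 0)) (RReg 7)) (RSet 4 (RReg 6)) Skip))).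

Definition bisect_cmd : cmd :=
  While (BRLt (RReg 1) (RMul (RReg 5) (RReg 3))) halve_cmd.

(** Register 4 still holds its initial value 0 when the bisection starts: this is
    the left end of the first bracket. *)
Definition projection_cmd : cmd :=
  Seq min_cmd
  (Seq max_cmd
  (Seq (RSet 5 (RDiv (RConst (Posz 1)) (RSub (RReg 0) (RReg 2))))
  (Seq bisect_cmd
  (Seq dual_cmd
  (Seq (RSet 0 (RReg 7)) (RSet 1 (RAdd (RReg 7) (RReg 1)))))))).

(** * Correctness and running time *)

Section Correctness.
Context {R : realType}.
Implicit Types (st : @state R) (beta delta : R).

Lemma array_ofE n (v : 'rV[R]_n) (i : 'I_n) : array_of v i = v 0 i.
Proof. by rewrite /array_of valK. Qed.

(** The part of the memory that is constant until the result is written. *)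
Definition stores n (pbar b : 'rV[R]_n) beta delta st : Prop :=
  [/\ ireg st 0 = n, rarr st 0 = array_of pbar, rarr st 1 = array_of b,
      rreg st 0 = beta & rreg st 1 = delta].

Lemma runs_slope n (pbar b : 'rV[R]_n) beta delta st :
  stores pbar b beta delta st ->
  runs slope_cmd st (7 + n * 26)
    (scan st 7 0 (dual_slope pbar b beta (rreg st 6))).
Proof.
move=> [nE pbarE bE betaE _].
pose F k := array_of pbar k * (array_of b k - beta) /
            (1 + rreg st 6 * (array_of b k - beta)).
have := @runs_sum R st 7 (RDiv (RMul (RArr 0 (IReg 1)) deviation) (scaled 6)) F.
rewrite nE big_mkord /dual_slope (eq_bigr (fun s : 'I_n =>
  pbar 0 s * (b 0 s - beta) / (1 + rreg st 6 * (b 0 s - beta)))); last first.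
  by move=> s _; rewrite /F !array_ofE.
by move=> run; apply: run => k a _; rewrite /= pbarE bE betaE.
Qed.

Lemma runs_dual n (pbar b : 'rV[R]_n) beta delta st :
  stores pbar b beta delta st ->
  runs dual_cmd st (7 + n * 22)
    (scan st 7 0 (dual_obj pbar b beta (rreg st 4))).
Proof.
move=> [nE pbarE bE betaE _].
pose F k := array_of pbar k * ln (1 + rreg st 4 * (array_of b k - beta)).
have := @runs_sum R st 7 (RMul (RArr 0 (IReg 1)) (RLog (scaled 4))) F.
rewrite nE big_mkord /dual_obj (eq_bigr (fun s : 'I_n =>
  pbar 0 s * ln (1 + rreg st 4 * (b 0 s - beta)))); last first.
  by move=> s _; rewrite /F !array_ofE.
by move=> run; apply: run => k a _; rewrite /= pbarE bE betaE.
Qed.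

Lemma runs_min n (pbar b : 'rV[R]_n.+1) beta delta st :
  stores pbar b beta delta st ->
  runs min_cmd st (8 + n.+1 * 14) (scan st 2 0 (vmin b)).
Proof.
move=> [nE _ bE _ _].
have body k a : (k < ireg st 0)%N ->
    runs (If (BRLt (RArr 1 (IReg 1)) (RReg 2)) (RSet 2 (RArr 1 (IReg 1))) Skip)
      (scan st 2 k a) 7 (scan st 2 k (Num.min (array_of b k) a)).
  move=> _; apply: (runs_If (T := 3)); rewrite /= bE minElt.
  case: ifP => _; last by exists 0%N => //; exact: exec_Skip.
  have := runs_RSet (scan st 2 k a) 2 (RArr 1 (IReg 1)).
  by rewrite /= bE scan_rreg.
have := runs_fold (RArr 1 (IConst 0)) body; rewrite /= bE nE big_mkord.
rewrite /vmin -(array_ofE b 0) (eq_bigr (b 0)) => [|s _]; last exact: array_ofE.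
by apply: runs_le; lia.
Qed.

Lemma runs_max n (pbar b : 'rV[R]_n.+1) beta delta st :
  stores pbar b beta delta st ->
  runs max_cmd st (8 + n.+1 * 14) (scan st 3 0 (vmax b)).
Proof.
move=> [nE _ bE _ _].
have body k a : (k < ireg st 0)%N ->
    runs (If (BRLt (RArr 1 (IReg 1)) (RReg 3)) Skip (RSet 3 (RArr 1 (IReg 1))))
      (scan st 3 k a) 7 (scan st 3 k (Num.max (array_of b k) a)).
  move=> _; apply: (runs_If (T := 3)); rewrite /= bE maxElt.
  case: ifP => _; first by exists 0%N => //; exact: exec_Skip.
  have := runs_RSet (scan st 3 k a) 3 (RArr 1 (IReg 1)).
  by rewrite /= bE scan_rreg.
have := runs_fold (RArr 1 (IConst 0)) body; rewrite /= bE nE big_mkord.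
rewrite /vmax -(array_ofE b 0) (eq_bigr (b 0)) => [|s _]; last exact: array_ofE.
by apply: runs_le; lia.
Qed.

Lemma runs_halve n (pbar b : 'rV[R]_n) beta delta st :
  stores pbar b beta delta st ->
  let w := rreg st 5 / 2 in let m := rreg st 4 + w in
  exists st', [/\ runs halve_cmd st (21 + n * 26) st',
    stores pbar b beta delta st', rreg st' 3 = rreg st 3,
    rreg st' 4 = if 0 < dual_slope pbar b beta m then m else rreg st 4 &
    rreg st' 5 = w].
Proof.
move=> stored w m; have [nE pbarE bE betaE deltaE] := stored.
pose st1 := set_rreg st 5 w; pose st2 := set_rreg st1 6 m.
have run1 : runs (RSet 5 (RDiv (RReg 5) (RConst (Posz 2)))) st 4 st1.
  exact: runs_RSet.
have run2 : runs (RSet 6 (RAdd (RReg 4) (RReg 5))) st1 4 st2.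
  exact: (runs_RSet st1 6 (RAdd (RReg 4) (RReg 5))).
have run3 := @runs_slope n pbar b beta delta st2 stored.
pose st3 := scan st2 7 0 (dual_slope pbar b beta m).
pose st4 := if 0 < dual_slope pbar b beta m then set_rreg st3 4 m else st3.
have run4 : runs (If (BRLt (RConst (Posz 0)) (RReg 7)) (RSet 4 (RReg 6)) Skip)
    st3 5 st4.
  apply: (runs_If (T := 2)); rewrite /= /st4; case: ifP => _.
    exact: (runs_RSet st3 4 (RReg 6)).
  by exists 0%N => //; exact: exec_Skip.
exists st4; split; rewrite /st4; try by case: ifP.
apply: runs_le (runs_Seq run1 (runs_Seq run2 (runs_Seq run3 run4))); lia.
Qed.

(** [K] bounds the number of halvings still to be done: each one halves the
    width in register 5, and the loop stops once w * vmax b <= delta. *)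
Lemma runs_bisect n (pbar b : 'rV[R]_n.+1) beta delta K st :
  simplex pbar -> (forall s, 0 < pbar 0 s) -> vmin b < beta ->
  stores pbar b beta delta st -> rreg st 3 = vmax b ->
  bracket pbar b beta (rreg st 4) (rreg st 5) ->
  rreg st 5 * vmax b <= delta * 2 ^+ K ->
  exists st', [/\ runs bisect_cmd st (5 + K * (26 + n.+1 * 26)) st',
    stores pbar b beta delta st',
    bracket pbar b beta (rreg st' 4) (rreg st' 5) &
    rreg st' 5 * vmax b <= delta].
Proof.
move=> pbarS pbar0 bmin; elim: K st => [|K IHK] st stored maxE brack wM.
  exists st; split=> //; last by move: wM; rewrite expr0 mulr1.
  apply: runs_WhileF; rewrite /= maxE -leNgt.
  by have [_ _ _ _ ->] := stored; move: wM; rewrite expr0 mulr1.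
have [wM1|wM1] := leP (rreg st 5 * vmax b) delta.
  exists st; split=> //; apply: runs_le (runs_WhileF _ _).
    by rewrite /=; lia.
  by rewrite /= maxE -leNgt; have [_ _ _ _ ->] := stored.
have [st1 [run1 stored1 max1 lo1 w1]] := runs_halve stored.
have [||||st2 [run2 stored2 brack2 wM2]] := IHK st1.
- exact: stored1.
- by rewrite max1.
- by rewrite lo1 w1; exact: bracket_halve.
- by rewrite w1 mulrAC ler_pdivrMr// -mulrA -exprSr.
exists st2; split=> //; apply: runs_le (runs_WhileT _ run1 run2).
  by rewrite /=; lia.
by rewrite /= maxE; have [_ _ _ _ ->] := stored.
Qed.

(** For x >= 1, ln 2 >= 1 / 2 gives log2 x <= 2 * ln x, and rounding up to an
    integer costs at most 1; both terms are bounded by means of the maximum. *)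
Lemma exp2_ge_log (x : R) :
  exists K : nat, x <= 2 ^+ K /\ K%:R <= 3 * Num.max 1 (ln x).
Proof.
set M := Num.max 1 (ln x).
have M1 : 1 <= M by rewrite le_max lexx.
have xM : x <= expR M.
  have [x0|x0] := leP x 0; first exact: le_trans x0 (expR_ge0 _).
  by rewrite -[leLHS](lnK x0) ler_expR le_max lexx orbT.
have ln2 : 2^-1 <= ln 2 :> R.
  have := @ln_le_subr1 R 2^-1; rewrite invr_gt0 ltr0n => /(_ isT).
  rewrite lnV ?posrE//; lra.
have := truncnS_gt (2 * M); have := @truncn_itv R (2 * M).
set k := Num.truncn _ => + kM; case/(_ _)/andP; first lra.
move=> kM' _; exists k.+1; split; last by rewrite -natr1; lra.
apply: le_trans xM _; rewrite -[leRHS]lnK ?posrE ?exprn_gt0// ler_expR lnXn//.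
rewrite -[leRHS]mulr_natl; apply: (le_trans (y := k.+1%:R * 2^-1)); first lra.
by rewrite ler_wpM2l.
Qed.

End Correctness.

(* The number of states is S = n.+1. *)
Theorem theorem7 (R : realType) :
  exists (c : cmd) (C : nat),
    forall (n : nat) (pbar b : 'rV[R]_n.+1) (beta omega delta : R),
      simplex pbar -> (forall s, 0 < pbar 0 s) ->
      (forall s, 0 <= b 0 s) -> 0 <= beta ->
      0 < omega -> vmin b + omega <= beta ->
      0 < delta ->
      exists2 t : nat, solves_in_time c pbar b beta delta t &
        t%:R <= C%:R * n.+1%:R * Num.max 1 (ln (vmax b / (delta * omega))).
Proof.
(* per state, everything but the bisection costs at most 100 and a halving at
   most 52; there are at most 3 * L halvings, so 100 + 3 * 52 <= 300 will do *)
exists projection_cmd, 300%N => n pbar b beta omega delta.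
move=> pbarS pbar0 b0 beta0 omega0 omega_le delta0.
have bmin : vmin b < beta by apply: lt_le_trans omega_le; rewrite ltrDl.
have om0 : 0 < beta - vmin b by rewrite subr_gt0.
have M0 : 0 <= vmax b := le_trans (b0 0) (le_vmax b 0).
have [K [leK Kle]] := exp2_ge_log (vmax b / (delta * omega)).
pose st0 := input pbar b beta delta.
have stored0 : stores pbar b beta delta st0 by [].
have run1 := runs_min stored0.
pose st1 := scan st0 2 0 (vmin b).
have run2 := @runs_max R n pbar b beta delta st1 stored0.
pose st2 := scan st1 3 0 (vmax b).
pose e3 := RDiv (RConst (Posz 1)) (RSub (RReg 0) (RReg 2)).
have run3 := runs_RSet st2 5 e3.
pose st3 := set_rreg st2 5 (1 / (beta - vmin b)).
have stored3 : stores pbar b beta delta st3 by [].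
have brack3 : bracket pbar b beta (rreg st3 4) (rreg st3 5).
  exact: bracket_init.
(* the width is 1 / (beta - vmin b), at most 1 / omega *)
have wM3 : rreg st3 5 * vmax b <= delta * 2 ^+ K.
  rewrite /= div1r mulrC ler_pdivrMr//.
  move: leK; rewrite ler_pdivrMr ?mulr_gt0// => /le_trans; apply.
  rewrite mulrCA mulrA; apply: ler_wpM2l; last by rewrite lerBrDl.
  by rewrite mulr_ge0 ?exprn_ge0// ltW.
have [st4 [run4 stored4 brack4 wM4]] :=
  runs_bisect pbarS pbar0 bmin stored3 erefl brack3 wM3.
have run5 := runs_dual stored4.
pose g := dual_obj pbar b beta (rreg st4 4).
pose st5 := scan st4 7 0 g.
have run6 := runs_RSet st5 0 (RReg 7); pose st6 := set_rreg st5 0 g.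
have run7 := runs_RSet st6 1 (RAdd (RReg 7) (RReg 1)).
have [t tT run] := runs_Seq run1 (runs_Seq run2 (runs_Seq run3
  (runs_Seq run4 (runs_Seq run5 (runs_Seq run6 run7))))).
exists t.
  eexists; first exact: run.
  have [_ _ _ _ deltaE] := stored4.
  by rewrite /= deltaE; exact: bracket_solves brack4 wM4.
have {}tT : (t <= n.+1 * (100 + K * 52))%N.
  apply: leq_trans tT _; rewrite /=.
  have := leq_pmull K (ltn0Sn n); lia.
set L := Num.max _ _ in Kle *.
have L1 : 1 <= L by rewrite le_max lexx.
apply: (le_trans (y := (n.+1 * (100 + K * 52))%:R)); first by rewrite ler_nat.
rewrite natrM [300%:R * _]mulrC -mulrA ler_wpM2l// natrD natrM; lra.
Qed.
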